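(* Let $X=\ell_2(\mathbb{R})$, let $C=\{x\in X:\|x\|\le 1\}$, $U=\{x\in X:\|x\|<2\}$ and $S_X=\{x\in X:\|x\|=1\}$. There exists a function $F:U\to\mathbb{R}$ such that: (i) $F$ is (real) analytic on $U$; (ii) $F$ is convex on $U$, with $D^2F(x)(v,v)\ge 1$ for every $x\in U$ and every $v\in S_X$; (iii) $F$ is bounded on $C$; and (iv) the restriction $F|_C$ has no continuous convex extension to the whole space $X$, i.e. there is no continuous convex function $H:X\to\mathbb{R}$ with $H=F$ on $C$.
   Context: $\ell_2(\mathbb{R})$ is the real Hilbert space of square-summable real sequences indexed by $\{1,2,3,\dots\}$ with its usual norm $\|\cdot\|$. $D^2F(x)$ denotes the second Fréchet derivative of $F$ at $x$, viewed as a bilinear form. *)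

(* Defs.v *)
From HB Require Import structures.
From mathcomp Require Import all_boot all_order all_algebra.
From mathcomp Require Import all_classical all_reals all_analysis.
From mathcomp Require Import ring lra.
Import Order.TTheory GRing.Theory Num.Theory.
Import numFieldNormedType.Exports.

Set Implicit Arguments.
Unset Strict Implicit.
Unset Printing Implicit Defensive.

Local Open Scope classical_set_scope.
Local Open Scope ring_scope.

Section ell2.
Context (R : realType).
Implicit Types x y : nat -> R.

Definition sqr_summable x : bool := `[< cvgn [series x n ^+ 2]_n >].

Lemma sqr_summableP x : reflect (cvgn [series x n ^+ 2]_n) (sqr_summable x).
Proof. exact: asboolP. Qed.

Lemma sqr_summable_submod : submod_closed sqr_summable.
Proof.
split.
  apply/sqr_summableP.
  rewrite (_ : series _ = cst 0); first exact: is_cvg_cst.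
  by apply/funext => n; rewrite /series/= big1// => i _; rewrite expr0n.
move=> a x y /sqr_summableP xs /sqr_summableP ys; apply/sqr_summableP.
apply: (@series_le_cvg _ _
  ((2 * a ^+ 2) *: (fun n => x n ^+ 2) + 2 *: (fun n => y n ^+ 2))).
- by move=> n; exact: sqr_ge0.
- move=> n; rewrite -[leRHS]/(2 * a ^+ 2 * x n ^+ 2 + 2 * y n ^+ 2).
  by rewrite addr_ge0// ?(mulr_ge0 _ (sqr_ge0 _))// (mulr_ge0 _ (sqr_ge0 _)).
- move=> n; rewrite -[leLHS]/((a * x n + y n) ^+ 2).
  rewrite -[leRHS]/(2 * a ^+ 2 * x n ^+ 2 + 2 * y n ^+ 2).
  have := sqr_ge0 (a * x n - y n); nra.
- by apply: is_cvg_seriesD; exact: is_cvg_seriesZ.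
Qed.

HB.instance Definition _ := GRing.isSubmodClosed.Build R (nat -> R)
  sqr_summable sqr_summable_submod.

(* The sequences are indexed from 0. *)
Record ell2 := Ell2 { ell2_seq :> nat -> R; _ : ell2_seq \in sqr_summable }.

HB.instance Definition _ := [isSub for ell2_seq].
HB.instance Definition _ := [Choice of ell2 by <:].
HB.instance Definition _ := [SubChoice_isSubLmodule of ell2 by <:].

Implicit Types u v : ell2.

Lemma ell2_cvg u : cvgn [series u n ^+ 2]_n.
Proof. by case: u => u /= /sqr_summableP. Qed.

Lemma ell2DE u v n : (u + v) n = u n + v n. Proof. by []. Qed.
Lemma ell2ZE (a : R) u n : (a *: u) n = a * u n. Proof. by []. Qed.

Definition ell2_norm u : R := Num.sqrt (limn [series u n ^+ 2]_n).

Let sumsq_ge0 u : 0 <= limn [series u n ^+ 2]_n.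
Proof.
apply: limr_ge; first exact: ell2_cvg.
by apply: nearW => n; apply: sumr_ge0 => i _; exact: sqr_ge0.
Qed.

Let ell2_norm_sqr u : ell2_norm u ^+ 2 = limn [series u n ^+ 2]_n.
Proof. by rewrite sqr_sqrtr. Qed.

Let ell2_norm_ge0 u : 0 <= ell2_norm u.
Proof. exact: sqrtr_ge0. Qed.

Lemma ell2_normZ (a : R) u : ell2_norm (a *: u) = `|a| * ell2_norm u.
Proof.
rewrite -sqrtr_sqr /ell2_norm -sqrtrM ?sqr_ge0//; congr Num.sqrt.
rewrite (_ : (fun n => _) = a ^+ 2 *: (fun n => u n ^+ 2)).
  by rewrite (lim_seriesZ _ (@ell2_cvg u)).
by apply/funext => n; rewrite ell2ZE exprMn.
Qed.

Lemma ell2_norm0_eq0 u : ell2_norm u = 0 -> u = 0.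
Proof.
move=> u0; apply/val_inj/funext => n; rewrite -[RHS]/(0 : R) /=.
apply/eqP; rewrite -sqrf_eq0 eq_le sqr_ge0 andbT.
have u2_ge0 i : 0 <= u i ^+ 2 by exact: sqr_ge0.
have <- : limn [series u n ^+ 2]_n = 0 by rewrite -ell2_norm_sqr u0 expr0n.
apply: (@le_trans _ _ ([series u n ^+ 2]_n n.+1)).
  by rewrite /series/= big_nat_recr//= lerDr sumr_ge0.
apply: nondecreasing_cvgn_le; last exact: ell2_cvg.
by apply: nondecreasing_series => i _ _; exact: u2_ge0.
Qed.

Lemma ell2_ler_normD u v : ell2_norm (u + v) <= ell2_norm u + ell2_norm v.
Proof.
have [u0|u0] := eqVneq (ell2_norm u) 0.
  by rewrite u0 (ell2_norm0_eq0 u0) !add0r.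
have [v0|v0] := eqVneq (ell2_norm v) 0.
  by rewrite v0 (ell2_norm0_eq0 v0) !addr0.
set a := ell2_norm u in u0 *; set b := ell2_norm v in v0 *.
have a0 : 0 < a by rewrite lt_neqAle eq_sym u0 ell2_norm_ge0.
have b0 : 0 < b by rewrite lt_neqAle eq_sym v0 ell2_norm_ge0.
rewrite -(@ler_pXn2r _ 2) ?nnegrE ?addr_ge0 ?ell2_norm_ge0//.
pose c := (a + b) / a; pose d := (a + b) / b.
have -> : (a + b) ^+ 2 = c * a ^+ 2 + d * b ^+ 2.
  by rewrite /c /d; field; rewrite u0 v0.
rewrite /a /b !ell2_norm_sqr.
pose x n := u n ^+ 2; pose y n := v n ^+ 2.
have xs : cvgn (series (c *: x)) by apply: is_cvg_seriesZ; exact: ell2_cvg.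
have ys : cvgn (series (d *: y)) by apply: is_cvg_seriesZ; exact: ell2_cvg.
have -> : c * limn (series x) = limn (series (c *: x)).
  by rewrite lim_seriesZ//; exact: ell2_cvg.
have -> : d * limn (series y) = limn (series (d *: y)).
  by rewrite lim_seriesZ//; exact: ell2_cvg.
rewrite -(lim_seriesD xs ys); apply: ler_lim; first exact: ell2_cvg.
  exact: is_cvg_seriesD.
apply: nearW => n; apply: ler_sum => i _; rewrite -[leLHS]/((u i + v i) ^+ 2).
rewrite -[leRHS]/(c * u i ^+ 2 + d * v i ^+ 2).
rewrite -subr_ge0.
have -> : c * u i ^+ 2 + d * v i ^+ 2 - (u i + v i) ^+ 2 =
  (b * u i - a * v i) ^+ 2 / (a * b).
  by rewrite /c /d; field; rewrite u0 v0.
by rewrite divr_ge0 ?sqr_ge0// mulr_ge0 ?ltW.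
Qed.

HB.instance Definition _ :=
  Lmodule_isNormed.Build R ell2 ell2_ler_normD ell2_normZ ell2_norm0_eq0.

End ell2.

Section calculus.
Context (R : realType) (X : normedModType R).

Definition multilinear_form k (A : ('I_k -> X) -> R) :=
  forall (i : 'I_k) (v : 'I_k -> X), scalar (fun x => A [eta v with i |-> x]).

(* Near [a], [f] is the sum of a power series of bounded multilinear forms,
   normally convergent on a ball: [M k] bounds the norm of [A k]. *)
Definition analytic_at (f : X -> R) (a : X) :=
  exists (A : forall k, ('I_k -> X) -> R) (M : nat -> R) (r : R),
  [/\ 0 < r,
      forall k, multilinear_form (A k) /\
        forall v, `|A k v| <= M k * \prod_(i < k) `|v i|,
      (forall k, 0 <= M k) /\ cvgn [series M k * r ^+ k]_k
    & forall h, `|h| < r -> [series A k (fun=> h)]_k @ \oo --> f (a + h)].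

(* [B], seen as the map x |-> B x from X to its dual, is the derivative at [a]
   of the Frechet derivative ['d f]; the last clause is differentiability for
   the dual norm. *)
Definition is_diff2 (f : X -> R) (a : X) (B : {biscalar X}) :=
  [/\ continuous (fun p : X * X => B p.1 p.2 : R),
      \forall x \near a, differentiable f x
    & forall e : R, 0 < e -> \forall x \near a, forall v,
        `|'d f x v - 'd f a v - B (x - a) v| <= e * `|x - a| * `|v| ].

End calculus.

(* Main.v *)
From HB Require Import structures.
Require Import Defs.
From mathcomp Require Import all_boot all_order all_algebra.
From mathcomp Require Import all_classical all_reals all_analysis.
From mathcomp Require Import ring lra.
Import Order.TTheory GRing.Theory Num.Theory.
Import numFieldNormedType.Exports.

(** The function is F x = |x|^2 + sum_n (l_n x)^(2n), where l_n is the unit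
    functional l_n x = (5 x_0 + 12 x_(n+1)) / 13.

    On the ball of radius 2 the first coordinate contributes at most 10/13 < 1
    to l_n x and the second one tends to 0, so the sum is dominated near every
    point by a geometric series ([tilted_form_majorant]).  This survives adding
    a small constant to |l_n x|, and Cauchy-type estimates then turn each
    binomial expansion into a power series in x with geometric bounds
    ([ridge_taylor], [ridge_analytic]); the same estimates, applied to F and to
    its gradient, identify the first two derivatives
    ([example_fun_differentiable], [example_fun_diff2]).  Each summand is
    convex, so |x|^2 alone makes D^2F at least 2 on unit vectors.

    On the unit ball the unit vectors u_n representing the l_n are so far
    apart that at most one l_n x is close to 1 in absolute value; hence F is
    bounded there ([tilted_form_gram], [tilted_sum_bounded]).

    At u_n, however, the summand of index n has a slope of order n in
    the direction of y = (26/5) e_0, because l_n y = 2 > 1 = l_n u_n, and from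
    u_n the direction opposite to y points into the unit ball.  So a convex H
    that agrees with F on the unit ball satisfies H y >= n/2 for every large n,
    which is absurd ([tilted_sum_steep], [no_convex_extension]). *)

Set Implicit Arguments.
Unset Strict Implicit.
Unset Printing Implicit Defensive.

Local Open Scope classical_set_scope.
Local Open Scope ring_scope.

(** * Real series *)

Section series_lemmas.
Context (R : realType).
Implicit Types f g : nat -> R.

Lemma series_dominated f g :
  (forall n, `|f n| <= g n) -> cvgn (series g) ->
  cvgn (series f) /\ `|limn (series f)| <= limn (series g).
Proof.
move=> fg cg.
have g0 n : 0 <= g n by exact: le_trans (normr_ge0 _) (fg n).
have cf : cvgn [normed series f] by apply: series_le_cvg fg cg.
split; first exact: (@normed_cvg R R^o).
by apply: le_trans (@lim_series_norm R R^o f cf) _; exact: lim_series_le.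
Qed.

Lemma cvg_series_scale f (k : R) :
  cvgn (series f) -> cvgn [series k * f n]_n.
Proof. exact: (@is_cvg_seriesZ R f k). Qed.

Lemma lim_series_scale f (k : R) : cvgn (series f) ->
  limn [series k * f n]_n = k * limn (series f).
Proof. exact: (@lim_seriesZ R f k). Qed.

Lemma cvg_series_linear f g (k : R) : cvgn (series f) -> cvgn (series g) ->
  cvgn [series k * f n + g n]_n.
Proof.
by move=> /(@cvg_series_scale _ k) cf cg; exact: (is_cvg_seriesD cf cg).
Qed.

Lemma lim_series_linear f g (k : R) : cvgn (series f) -> cvgn (series g) ->
  limn [series k * f n + g n]_n = k * limn (series f) + limn (series g).
Proof.
move=> cf cg; rewrite -(lim_series_scale k cf).
exact: (lim_seriesD (@cvg_series_scale _ k cf) cg).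
Qed.

Lemma lim_series_sum (f : nat -> nat -> R) (K : nat) :
  (forall k, cvgn (series (f k))) ->
  cvgn [series \sum_(0 <= k < K) f k n]_n /\
  limn [series \sum_(0 <= k < K) f k n]_n =
  \sum_(0 <= k < K) limn (series (f k)).
Proof.
move=> cf; elim: K => [|K [cK lK]].
  rewrite big_geq//; under eq_fun do rewrite big_geq//.
  have -> : [series 0 : R]_n = cst 0.
    by apply/funext => n; rewrite /series/= big1.
  by split; [exact: is_cvg_cst|exact: lim_cst].
rewrite big_nat_recr//= -lK.
have -> : (fun n => \sum_(0 <= k < K.+1) f k n) =
    (fun n => 1 * \sum_(0 <= k < K) f k n + f K n).
  by apply/funext => n; rewrite big_nat_recr//= mul1r.
split; first exact: cvg_series_linear.
by rewrite lim_series_linear// mul1r.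
Qed.

Lemma series_le_lim f N : (forall n, 0 <= f n) -> cvgn (series f) ->
  \sum_(0 <= n < N) f n <= limn (series f).
Proof.
move=> f0 cf; apply: (@nondecreasing_cvgn_le R (series f)) => //.
by apply: nondecreasing_series => i _ _; exact: f0.
Qed.

Lemma series_ge0_lim f : (forall n, 0 <= f n) -> cvgn (series f) ->
  0 <= limn (series f).
Proof. by move=> f0 cf; have := series_le_lim 0 f0 cf; rewrite big_geq. Qed.

Lemma series_finite f N : (forall n, (N <= n)%N -> f n = 0) ->
  series f @ \oo --> \sum_(0 <= n < N) f n.
Proof.
move=> f0; apply: (@cvg_near_cst _ _ _ _ \oo).
exists N => // n /= Nn; rewrite /series/= (big_cat_nat (leq0n N) Nn)/=.
rewrite [X in _ + X]big_nat [X in _ + X]big1 ?addr0// => i /andP[Ni _]; exact: f0.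
Qed.

Lemma cvg_series_near_geometric f (q : R) : 0 <= q < 1 ->
  (\forall n \near \oo, `|f n| <= q ^+ n) -> cvgn (series f).
Proof.
move=> /andP[q0 q1] [N _ fN].
pose g n := if (n < N)%N then `|f n| else 0.
have cg : cvgn (series g).
  apply/cvg_ex; exists (\sum_(0 <= n < N) g n); apply: series_finite => n.
  by rewrite leqNgt /g => /negbTE ->.
have cq : cvgn (series (geometric 1 q)).
  by apply: is_cvg_geometric_series; rewrite ger0_norm.
have [] := @series_dominated f (fun n => 1 * geometric 1 q n + g n) _ _ => //.
- move=> n; rewrite /geometric/= !mul1r /g.
  case: ltnP => [_|/fN/=]; last by rewrite addr0.
  by rewrite lerDr exprn_ge0.
- exact: cvg_series_linear.
Qed.

End series_lemmas.

(** * Binomial estimates and ridge series *)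

Section binomial_estimates.
Context (R : realType).
Implicit Types l h r t : R.

Lemma exprDn_wide (x y : R) d N : (d < N)%N ->
  (x + y) ^+ d = \sum_(0 <= k < N) x ^+ (d - k) * y ^+ k *+ 'C(d, k).
Proof.
move=> dN; rewrite (big_cat_nat (leq0n d.+1) dN)/= [X in _ = _ + X]big_nat.
rewrite [X in _ = _ + X]big1 ?addr0 => [|k /andP[dk _]]; last first.
  by rewrite bin_small.
by rewrite exprDn big_mkord.
Qed.

(** This plays the role of Cauchy's estimate for the coefficients of a power
    series: a single term is at most the whole sum of nonnegative terms. *)
Lemma binomial_term_le l r d k : 0 <= l -> 0 <= r ->
  l ^+ (d - k) * r ^+ k *+ 'C(d, k) <= (l + r) ^+ d.
Proof.
move=> l0 r0; rewrite (@exprDn_wide l r d (d.+1 + k.+1)) ?leq_addr//.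
rewrite big_mkord (bigD1 (Ordinal (leq_addl d.+1 k.+1)))//= lerDl.
by apply: sumr_ge0 => i _; rewrite mulrn_wge0// mulr_ge0// exprn_ge0.
Qed.

(** Every term of index k >= K gains a factor t^k <= t^K over the corresponding
    term of (|l| + r)^d, and those terms are nonnegative. *)
Lemma binomial_tail_le l h r t d K : 0 <= t <= 1 -> 0 <= r -> `|h| <= t * r ->
  `|(l + h) ^+ d - \sum_(0 <= k < K) l ^+ (d - k) * h ^+ k *+ 'C(d, k)|
  <= t ^+ K * (`|l| + r) ^+ d.
Proof.
move=> /andP[t0 t1] r0 htr.
have Kd : (K <= K + d.+1)%N by rewrite leq_addr.
have dK : (d < K + d.+1)%N by rewrite leq_addl.
rewrite !(exprDn_wide _ _ dK) (big_cat_nat (leq0n K) Kd)/= addrAC subrr add0r.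
apply: le_trans (ler_norm_sum _ _ _) _.
rewrite (big_cat_nat (leq0n K) Kd)/= mulrDr ler_wpDl//.
  rewrite mulr_ge0 ?exprn_ge0//; apply: sumr_ge0 => k _.
  by rewrite mulrn_wge0// mulr_ge0 ?exprn_ge0.
rewrite mulr_sumr big_nat [leRHS]big_nat; apply: ler_sum => k /andP[Kk _].
rewrite normrMn mulrnAr lerMn2r; apply/orP; right.
rewrite normrM !normrX mulrCA ler_wpM2l ?exprn_ge0//.
apply: (@le_trans _ _ ((t * r) ^+ k)).
  by rewrite lerXn2r// nnegrE ?mulr_ge0.
by rewrite exprMn ler_wpM2r ?exprn_ge0// ler_wiXn2l.
Qed.

End binomial_estimates.

Section ridge_series.
Context (R : realType) (X : normedModType R) (L : nat -> X -> R).
Hypothesis L_scalar : forall n, scalar (L n).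
Hypothesis L_le : forall n x, `|L n x| <= `|x|.
Implicit Types (w W : nat -> R) (d : nat -> nat) (a h : X) (r t : R).

Let LD n x y : L n (x + y) = L n x + L n y.
Proof. by have := L_scalar n 1 x y; rewrite scale1r mul1r. Qed.

(** A series of ridge functions: weighted powers of linear functionals. *)
Definition ridge w d (x : X) := limn [series w n * L n x ^+ d n]_n.

(** If the series of these terms converges, [r] is a radius on which the
    expansions of all the summands around [a] are controlled at once. *)
Definition ridge_majorant W d r a n := W n * (`|L n a| + r) ^+ d n.

(** The homogeneous part of degree [k] of the expansion of the ridge series
    around [a], polarised. *)
Definition ridge_jet w d k a (v : 'I_k -> X) :=
  limn [series w n * (L n a ^+ (d n - k) *+ 'C(d n, k))
        * \prod_(i < k) L n (v i)]_n.

Section taylor.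
Variables (w W : nat -> R) (d : nat -> nat) (r : R) (a : X).
Hypotheses (r0 : 0 < r) (wW : forall n, `|w n| <= W n).
Hypothesis cW : cvgn (series (ridge_majorant W d r a)).

Let B := limn (series (ridge_majorant W d r a)).
Let W0 n : 0 <= W n. Proof. exact: le_trans (normr_ge0 _) (wW n). Qed.

Lemma ridge_jet_bound k (v : 'I_k -> X) :
  cvgn [series w n * (L n a ^+ (d n - k) *+ 'C(d n, k))
        * \prod_(i < k) L n (v i)]_n /\
  `|ridge_jet w d a v| <= B * r ^- k * \prod_(i < k) `|v i|.
Proof.
have -> : B * r ^- k * \prod_(i < k) `|v i| =
    r ^- k * \prod_(i < k) `|v i| * B by ring.
rewrite -(lim_series_scale _ cW).
apply: series_dominated; last exact: cvg_series_scale.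
move=> n /=; rewrite !normrM normr_prod.
have -> : r ^- k * (\prod_(i < k) `|v i|) * ridge_majorant W d r a n =
    W n * (r ^- k * (`|L n a| + r) ^+ d n) * \prod_(i < k) `|v i|.
  by rewrite /ridge_majorant; ring.
apply: ler_pM; first by rewrite mulr_ge0.
- by rewrite prodr_ge0.
- apply: ler_pM => //.
  rewrite ler_pdivlMl ?exprn_gt0// normrMn normrX mulrnAr mulrC.
  exact: binomial_term_le (ltW r0).
by apply: ler_prod => i _; rewrite normr_ge0 L_le.
Qed.

(** The bound [binomial_tail_le] is summed over the series: since it is
    proportional to the majorant, no interchange of the sums over [n] and [k]
    is needed. *)
Lemma ridge_taylor h t K : 0 <= t <= 1 -> `|h| <= t * r ->
  cvgn [series w n * L n (a + h) ^+ d n]_n /\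
  `|ridge w d (a + h) - \sum_(0 <= k < K) ridge_jet w d a (fun _ : 'I_k => h)|
  <= t ^+ K * B.
Proof.
move=> t01 htr.
have ch : cvgn [series w n * L n (a + h) ^+ d n]_n.
  have [|//|//] := @series_dominated _ (fun n => w n * L n (a + h) ^+ d n)
    (ridge_majorant W d r a).
  move=> n; rewrite normrM ler_pM// LD -[_ ^+ _]subr0.
  have := binomial_tail_le (L n a) (d n) 0 t01 (ltW r0)
    (le_trans (L_le n h) htr).
  by rewrite big_geq// expr0 mul1r.
split=> //.
pose f k n := w n * (L n a ^+ (d n - k) *+ 'C(d n, k))
  * \prod_(i < k) L n h.
have [cf lf] := @lim_series_sum R f K
  (fun k => (ridge_jet_bound (fun _ : 'I_k => h)).1).
have -> : ridge w d (a + h) - \sum_(0 <= k < K) ridge_jet w d a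
    (fun _ : 'I_k => h) =
    limn [series -1 * (\sum_(0 <= k < K) f k n) + w n * L n (a + h) ^+ d n]_n.
  by rewrite lim_series_linear// mulN1r addrC lf.
rewrite -(lim_series_scale _ cW).
apply: (series_dominated _ (cvg_series_scale cW)).2 => n /=.
rewrite mulN1r addrC.
have -> : \sum_(0 <= k < K) f k n = w n *
    \sum_(0 <= k < K) L n a ^+ (d n - k) * L n h ^+ k *+ 'C(d n, k).
  rewrite mulr_sumr; apply: eq_bigr => k _.
  by rewrite /f prodr_const card_ord -mulrA mulrnAl.
rewrite -mulrBr normrM /ridge_majorant mulrCA ler_pM// LD.
exact: binomial_tail_le t01 (ltW r0) (le_trans (L_le n h) htr).
Qed.

End taylor.

(** The degree [k] part is bounded by [B / r ^ k], so halving the radius makes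
    the expansion converge like a geometric series. *)
Lemma ridge_analytic w W d r a : 0 < r -> (forall n, `|w n| <= W n) ->
  cvgn (series (ridge_majorant W d r a)) -> analytic_at (ridge w d) a.
Proof.
move=> r0 wW cW; set B := limn (series (ridge_majorant W d r a)).
have W0 n : 0 <= W n by exact: le_trans (normr_ge0 _) (wW n).
have B0 : 0 <= B.
  apply: series_ge0_lim => // n.
  by rewrite mulr_ge0// exprn_ge0// addr_ge0// ltW.
exists (fun k => @ridge_jet w d k a), (fun k => B * r ^- k), (r / 2).
have half1 : `|2^-1 : R| < 1 by rewrite ger0_norm; lra.
split; first by rewrite divr_gt0.
- move=> k; split; last first.
    by move=> v; exact: (ridge_jet_bound r0 wW cW v).2.
  move=> i v c x y; rewrite /ridge_jet -lim_series_linear//; last 2 first.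
    exact: (ridge_jet_bound r0 wW cW _).1.
    exact: (ridge_jet_bound r0 wW cW _).1.
  congr (limn (series _)); apply/funext => n /=.
  have E z : \prod_(j < k) L n ([eta v with i |-> z] j) =
      L n z * \prod_(j < k | j != i) L n (v j).
    rewrite (bigD1 i)//= eqxx; congr (_ * _).
    by apply: eq_bigr => j /negbTE /= ->.
  by rewrite !E L_scalar; ring.
- split=> [k|]; first by rewrite mulr_ge0// invr_ge0 exprn_ge0// ltW.
  rewrite (_ : [series _]_k = series (geometric B 2^-1)).
    exact: is_cvg_geometric_series.
  congr series; apply/funext => k; rewrite /geometric/= exprMn -mulrA.
  by rewrite mulKf ?exprVn// expf_neq0// gt_eqF.
- move=> h hr; have t01 : 0 <= (2^-1 : R) <= 1 by apply/andP; split; lra.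
  have htr : `|h| <= 2^-1 * r by rewrite mulrC ltW.
  apply/cvgrPdist_le => e e0.
  have := cvg_geometric B half1.
  move=> /cvgrPdist_le/(_ e e0); apply: filterS => K.
  rewrite sub0r normrN => Be.
  apply: le_trans (ridge_taylor r0 wW cW K t01 htr).2 _.
  by apply: le_trans Be; rewrite mulrC ler_norm.
Qed.

(** Differentiating the summands costs only half of the radius: by
    [binomial_term_le] with [k = 1], [d * (c + r / 2) ^ (d - 1) * (r / 2)] is at
    most [(c + r) ^ d]. *)
Lemma ridge_majorant_deriv W d r a : 0 < r -> (forall n, 0 <= W n) ->
  cvgn (series (ridge_majorant W d r a)) ->
  cvgn (series (ridge_majorant (fun n => W n * (d n)%:R) (fun n => (d n).-1)
    (r / 2) a)).
Proof.
move=> r0 W0 cW.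
have r20 : 0 < r / 2 by rewrite divr_gt0.
apply: (series_dominated _ (@cvg_series_scale _ _ (r / 2)^-1 cW)).1 => n.
have l0 : 0 <= `|L n a| + r / 2 by rewrite addr_ge0// ltW.
rewrite /ridge_majorant ger0_norm ?mulr_ge0// ?exprn_ge0//.
rewrite -mulrA [leRHS]mulrCA ler_wpM2l// ler_pdivlMl//.
have -> : r / 2 * ((d n)%:R * (`|L n a| + r / 2) ^+ (d n).-1) =
    (`|L n a| + r / 2) ^+ (d n).-1 * (r / 2) *+ d n.
  by rewrite -mulr_natr; ring.
have := binomial_term_le (d n) 1 l0 (ltW r20).
by rewrite subn1 expr1 bin1 -[_ + r / 2 + r / 2]addrA -splitr.
Qed.

End ridge_series.

Section ridge_derivatives.
Context (R : realType) (X : normedModType R) (L : nat -> X -> R).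
Hypothesis L_scalar : forall n, scalar (L n).
Hypothesis L_le : forall n x, `|L n x| <= `|x|.
Implicit Types (w W : nat -> R) (d : nat -> nat) (a h v x : X) (r : R).

Definition ridge_grad w d x v : R := ridge_jet L w d x (fun _ : 'I_1 => v).

(** By [ridge_gradE] the gradient applied to a fixed [v] is again a ridge
    series, with new weights and exponents; the Hessian is the gradient of that
    series, and all its estimates are those of the first order. *)
Definition ridge_hess w d x h v : R :=
  ridge_grad (fun n => w n * (d n)%:R * L n v) (fun n => (d n).-1) x h.

Lemma ridge_gradE w d x v : ridge_grad w d x v =
  ridge L (fun n => w n * (d n)%:R * L n v) (fun n => (d n).-1) x.
Proof.
congr (limn (series _)); apply/funext => n /=.
by rewrite big_ord1 subn1 bin1 -mulr_natr; ring.
Qed.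

Lemma ridge_hessE w d x h v : ridge_hess w d x h v =
  limn [series w n * (d n * (d n).-1)%:R * L n x ^+ (d n).-2
        * L n h * L n v]_n.
Proof.
congr (limn (series _)); apply/funext => n /=.
by rewrite big_ord1 subn1 bin1 -mulr_natr natrM; ring.
Qed.

Lemma ridge_hessC w d x h v : ridge_hess w d x h v = ridge_hess w d x v h.
Proof.
by rewrite !ridge_hessE; congr (limn (series _)); apply/funext => n /=; ring.
Qed.

Section first_order.
Variables (w W : nat -> R) (d : nat -> nat) (r : R) (a : X).
Hypotheses (r0 : 0 < r) (wW : forall n, `|w n| <= W n).
Hypothesis cW : cvgn (series (ridge_majorant L W d r a)).
Let B := limn (series (ridge_majorant L W d r a)).

Lemma ridge_grad_le v : `|ridge_grad w d a v| <= B / r * `|v|.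
Proof.
have := (ridge_jet_bound L_le r0 wW cW (fun _ : 'I_1 => v)).2.
by rewrite big_ord1 expr1.
Qed.

Lemma ridge_grad_scalar : scalar (ridge_grad w d a).
Proof.
move=> c x y; rewrite /ridge_grad /ridge_jet -lim_series_linear; last 2 first.
  exact: (ridge_jet_bound L_le r0 wW cW _).1.
  exact: (ridge_jet_bound L_le r0 wW cW _).1.
congr (limn (series _)); apply/funext => n /=.
by rewrite !big_ord1 L_scalar; ring.
Qed.

(** [ridge_taylor] with [K = 2] and [t = |h| / r]. *)
Lemma ridge_taylor1 h : `|h| <= r ->
  `|ridge L w d (a + h) - ridge L w d a - ridge_grad w d a h|
  <= B / r ^+ 2 * `|h| ^+ 2.
Proof.
move=> hr; have t01 : 0 <= `|h| / r <= 1.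
  by rewrite divr_ge0 ?(ltW r0)//= ler_pdivrMr// mul1r.
have htr : `|h| <= `|h| / r * r by rewrite divfK// gt_eqF.
have := (ridge_taylor L_scalar L_le r0 wW cW 2 t01 htr).2.
rewrite !big_nat_recr//= big_geq// add0r -/(ridge_grad w d a h).
have -> : ridge_jet L w d a (fun _ : 'I_0 => h) = ridge L w d a.
  congr (limn (series _)); apply/funext => n /=.
  by rewrite big_ord0 subn0 bin0 !mulr1.
rewrite opprD addrA => /le_trans; apply.
by rewrite expr_div_n [B / _ * _]mulrAC -mulrA mulrC.
Qed.

End first_order.

Section second_order.
Variables (w W : nat -> R) (d : nat -> nat) (r : R) (a : X).
Hypotheses (r0 : 0 < r) (wW : forall n, `|w n| <= W n).
Hypothesis cW : cvgn (series (ridge_majorant L W d r a)).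

Let W' n := W n * (d n)%:R.
Let d' n := (d n).-1.
Let B := limn (series (ridge_majorant L W' d' (r / 2) a)).
Let r20 : 0 < r / 2. Proof. by rewrite divr_gt0. Qed.
Let cW' : cvgn (series (ridge_majorant L W' d' (r / 2) a)).
Proof.
apply: ridge_majorant_deriv => // n; exact: le_trans (normr_ge0 _) (wW n).
Qed.

Let weight_le v n : `|w n * (d n)%:R * L n v| <= `|v| * W' n.
Proof.
rewrite !normrM mulrC [`|(d n)%:R|]ger0_norm// ler_pM ?mulr_ge0//.
by rewrite ler_wpM2r.
Qed.

Let majorantZ v :
  ridge_majorant L (fun n => `|v| * W' n) d' (r / 2) a =
  (fun n => `|v| * ridge_majorant L W' d' (r / 2) a n).
Proof. by apply/funext => n; rewrite /ridge_majorant -mulrA. Qed.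

Let cvZ v :
  cvgn (series (ridge_majorant L (fun n => `|v| * W' n) d' (r / 2) a)).
Proof. by rewrite majorantZ; exact: cvg_series_scale. Qed.

Let lvZ v : limn (series (ridge_majorant L (fun n => `|v| * W' n) d' (r / 2) a))
  = `|v| * B.
Proof. by rewrite majorantZ lim_series_scale. Qed.

Lemma ridge_hess_scalarl v : scalar (fun h => ridge_hess w d a h v).
Proof. exact: (ridge_grad_scalar r20 (weight_le v) (@cvZ v)). Qed.

Lemma ridge_hess_scalarr h : scalar (ridge_hess w d a h).
Proof.
move=> c u v; rewrite ridge_hessC ridge_hess_scalarl.
by rewrite ![ridge_hess w d a _ h]ridge_hessC.
Qed.

Lemma ridge_hess_le h v :
  `|ridge_hess w d a h v| <= B / (r / 2) * `|h| * `|v|.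
Proof.
apply: le_trans (ridge_grad_le r20 (weight_le v) (@cvZ v) h) _.
by rewrite lvZ le_eqVlt; apply/orP; left; apply/eqP; ring.
Qed.

Lemma ridge_grad_taylor h v : `|h| <= r / 2 ->
  `|ridge_grad w d (a + h) v - ridge_grad w d a v - ridge_hess w d a h v|
  <= B / (r / 2) ^+ 2 * `|h| ^+ 2 * `|v|.
Proof.
move=> hr; rewrite !ridge_gradE.
apply: le_trans (ridge_taylor1 r20 (weight_le v) (@cvZ v) hr) _.
by rewrite lvZ le_eqVlt; apply/orP; left; apply/eqP; ring.
Qed.

Lemma ridge_hess_ge0 v : (forall n, 0 <= w n) -> (forall n, ~~ odd (d n)) ->
  0 <= ridge_hess w d a v v.
Proof.
move=> w0 ed; rewrite ridge_hessE.
apply: series_ge0_lim; last first.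
  rewrite (_ : (fun n => _) = (fun n => w n * (d n)%:R * L n v
      * (L n a ^+ (d' n - 1) *+ 'C(d' n, 1)) * \prod_(i < 1) L n v)).
    exact: (ridge_jet_bound L_le r20 (weight_le v) (@cvZ v) _).1.
  by apply/funext => n /=; rewrite big_ord1 subn1 bin1 -mulr_natr natrM; ring.
move=> n /=; rewrite -mulrA mulr_ge0//; last by rewrite -expr2 sqr_ge0.
rewrite mulr_ge0// ?mulr_ge0//.
by rewrite exprn_even_ge0//; case: (d n) (ed n) => [|[|m]]//=; rewrite negbK.
Qed.

End second_order.

End ridge_derivatives.

(** * Differentiability from Taylor estimates *)

Section taylor_calculus.
Context (R : realType) (X : normedModType R).
Implicit Types (f : X -> R) (a h v : X).

Lemma near_dist_le a (e : R) : 0 < e -> \forall x \near a, `|x - a| <= e.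
Proof.
move=> e0; apply: filterS (@nbhsx_ballx _ _ a e e0) => x.
by rewrite -ball_normE/= distrC => /ltW.
Qed.

(** The linear approximation may be given as a bare function: it is packed into
    a continuous linear map here and is the differential by uniqueness. *)
Lemma differentiable_of_taylor f a (D : X -> R) (M c rho : R) :
  0 < rho -> 0 <= M -> scalar D -> (forall v, `|D v| <= M * `|v|) ->
  (forall h, `|h| <= rho -> `|f (a + h) - f a - D h| <= c * `|h| ^+ 2) ->
  differentiable f a /\ forall v, 'd f a v = D v.
Proof.
move=> rho0 M0 Dlin DM fD.
pose lD := GRing.isLinear.Build R X R^o _ D Dlin.
pose L : {linear X -> R^o} := HB.pack D lD.
have Lc : continuous L.
  apply/linear_bounded_continuous/ex_bound; exists M.
  suff : \forall x \near (0 : X), `|L x| <= M by [].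
  apply: filterS (near_dist_le (0 : X) ltr01) => x; rewrite subr0 => x1.
  by apply: le_trans (DM x) _; rewrite ler_piMr.
have Ltay : f \o shift a = cst (f a) + L +o_ (0 : X) id.
  apply/eqaddoP => e e0; near=> h.
  rewrite [leLHS](_ : _ = `|f (a + h) - f a - D h|); last first.
    by rewrite [a + h]addrC -addrA -opprD.
  have hm : `|h| <= Num.min rho (e / (`|c| + 1)).
    by near: h; apply: nbhs0_le; rewrite lt_min rho0 divr_gt0// ltr_wpDl.
  move: hm; rewrite le_min => /andP[hrho he].
  apply: le_trans (fD _ hrho) _; rewrite expr2 mulrA ler_wpM2r//.
  move: he; rewrite ler_pdivlMr ?ltr_wpDl// => he.
  have := ler_norm c; have := normr_ge0 h; nra.
have dL : 'd f a = L :> (X -> R) by exact: diff_unique.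
split; last by move=> v; rewrite dL.
by apply/diff_locallyP; rewrite dL.
Unshelve. all: by end_near. Qed.

Lemma bilinear_bounded_continuous (B : {biscalar X}) (M : R) :
  (forall u v, `|B u v| <= M * `|u| * `|v|) ->
  continuous (fun p : X * X => B p.1 p.2 : R).
Proof.
move=> BM [x y].
pose g (p : X * X) : R := M * `|p.1 - x| * `|p.2| + M * `|x| * `|p.2 - y|.
have g0 : g p @[p --> (x, y)] --> (0 : R).
  have -> : 0 = M * `|x - x| * `|y| + M * `|x| * `|y - y|.
    by rewrite !subrr !normr0 !mulr0 mul0r addr0.
  apply: cvgD; apply: cvgM => //.
  - apply: cvgM; first exact: cvg_cst.
    apply: cvg_norm; apply: cvgB; last exact: cvg_cst.
    exact: cvg_fst.
  - by apply: cvg_norm; exact: cvg_snd.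
  - exact: cvg_cst.
  - apply: cvg_norm; apply: cvgB; last exact: cvg_cst.
    exact: cvg_snd.
apply/cvgrPdist_le => e e0.
move/cvgrPdist_le : g0 => /(_ e e0); apply: filterS => -[p q] /=.
rewrite sub0r normrN /g/= => ge.
have -> : B x y - B p q = - (B (p - x) q + B x (q - y)).
  by rewrite linearBl linearBr/=; ring.
rewrite normrN; apply: le_trans (ler_normD _ _) _.
by apply: le_trans (lerD (BM _ _) (BM _ _)) _; apply: le_trans (ler_norm _) ge.
Qed.

(** A quadratic remainder of the gradient, uniform in the direction [v], is
    differentiability for the dual norm. *)
Lemma is_diff2_of_taylor f a (D : X -> X -> R) (B : {biscalar X}) (M c rho : R) :
  0 < rho -> 0 <= c ->
  (\forall x \near a, differentiable f x /\ forall v, 'd f x v = D x v) ->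
  (forall u v, `|B u v| <= M * `|u| * `|v|) ->
  (forall h v, `|h| <= rho ->
    `|D (a + h) v - D a v - B h v| <= c * `|h| ^+ 2 * `|v|) ->
  is_diff2 f a B.
Proof.
move=> rho0 c0 fD BM DB; split; first exact: bilinear_bounded_continuous BM.
  by apply: filterS fD => x [].
move=> e e0; have daD := (nbhs_singleton fD).2.
have c10 : 0 < c + 1 by rewrite ltr_wpDl.
near=> x => v.
have [_ dxD] : differentiable f x /\ forall v, 'd f x v = D x v by near: x.
rewrite dxD daD -[in D x v](subrK a x) [x - a + a]addrC.
have : `|x - a| <= Num.min rho (e / (c + 1)).
  by near: x; apply: near_dist_le; rewrite lt_min rho0 divr_gt0.
rewrite le_min => /andP[xrho xe]; apply: le_trans (DB _ _ xrho) _.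
rewrite expr2 mulrA ler_wpM2r// ler_wpM2r//.
move: xe; rewrite ler_pdivlMr//; have := normr_ge0 (x - a); nra.
Unshelve. all: by end_near. Qed.

Lemma analytic_atD f g a :
  analytic_at f a -> analytic_at g a -> analytic_at (fun x => f x + g x) a.
Proof.
move=> [A [M [r [r0 AM [M0 cM] fA]]]] [A' [M' [r' [r'0 AM' [M'0 cM'] gA]]]].
exists (fun k (v : 'I_k -> X) => A k v + A' k v),
   (fun k => M k + M' k), (Num.min r r').
have m0 : 0 <= Num.min r r' by rewrite le_min !ltW.
split; first by rewrite lt_min r0.
- move=> k; have [[Ak Akb] [A'k A'kb]] := (AM k, AM' k); split.
    by move=> i v c x y; rewrite Ak A'k mulrDr; ring.
  move=> v; rewrite mulrDl; apply: le_trans (ler_normD _ _) _.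
  by rewrite lerD.
- split=> [k|]; first by rewrite addr_ge0.
  have cMM : cvgn [series 1 * (M k * r ^+ k) + M' k * r' ^+ k]_k.
    exact: cvg_series_linear.
  apply: (series_dominated _ cMM).1 => k /=; rewrite mul1r.
  rewrite ger0_norm ?mulr_ge0 ?addr_ge0 ?exprn_ge0//.
  rewrite mulrDl lerD// ler_wpM2l//; apply: lerXn2r;
    by rewrite ?nnegrE ?(ltW r0) ?(ltW r'0) ?ge_min ?lexx ?orbT.
- move=> h; rewrite lt_min => /andP[hr hr'].
  rewrite (_ : [series _]_k = [series A k (fun=> h)]_k + [series A' k (fun=> h)]_k).
    exact: cvgD (fA _ hr) (gA _ hr').
  by apply/funext => n; rewrite /series/= big_split.
Qed.

Lemma biscalar_of_linear (b : X -> X -> R) : (forall u, scalar (b u)) ->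
  (forall v, scalar (b^~ v)) -> exists B : {biscalar X}, forall u v, B u v = b u v.
Proof.
move=> bl br.
pose lb := bilinear_isBilinear.Build R X X R _ _ b (conj br bl).
pose B : {biscalar X} := HB.pack b lb.
by exists B.
Qed.

End taylor_calculus.

(** * Convexity *)

Lemma convex_functionP (R : realType) (E : lmodType R) (D : set E) (f : E -> R) :
  convex_function D f <-> forall (t : R) x y, 0 <= t <= 1 -> D x -> D y ->
    f (t *: x + (1 - t) *: y) <= t * f x + (1 - t) * f y.
Proof.
split=> [fD t x y t01 Dx Dy|fD t x y Dx Dy].
  pose s : {i01 R} := Itv01 (andP t01).1 (andP t01).2.
  exact: (fD s x y (mem_set Dx) (mem_set Dy)).
apply: (fD t%:num x y) => //; last 2 first.
- exact: set_mem Dx.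
- exact: set_mem Dy.
by rewrite ge0 le1.
Qed.

(** In the induction step the defect is [t * (1 - t) * (x ^ n - y ^ n) * (x - y)],
    and both differences have the same sign. *)
Lemma convex_expr (R : realType) (n : nat) (t x y : R) : 0 <= t <= 1 ->
  0 <= x -> 0 <= y ->
  (t * x + (1 - t) * y) ^+ n <= t * x ^+ n + (1 - t) * y ^+ n.
Proof.
move=> /andP[t0 t1] x0 y0; have s0 : 0 <= 1 - t by rewrite subr_ge0.
elim: n => [|n IH]; first by rewrite !expr0 !mulr1 addrC subrK.
rewrite exprSr; apply: (@le_trans _ _
    ((t * x ^+ n + (1 - t) * y ^+ n) * (t * x + (1 - t) * y))).
  by rewrite ler_wpM2r// addr_ge0// mulr_ge0.
have xy : 0 <= (x ^+ n - y ^+ n) * (x - y).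
  have [xy|/ltW yx] := leP x y.
    by rewrite mulr_le0// subr_le0// lerXn2r.
  by rewrite mulr_ge0// subr_ge0// lerXn2r.
rewrite -subr_ge0 !exprSr (_ : _ - _ =
  t * (1 - t) * ((x ^+ n - y ^+ n) * (x - y))); last by ring.
by rewrite mulr_ge0// mulr_ge0.
Qed.

(** The square is convex, and [convex_expr] applies to the nonnegative
    squares. *)
Lemma convex_even_expr (R : realType) (n : nat) (t x y : R) : 0 <= t <= 1 ->
  (t * x + (1 - t) * y) ^+ n.*2 <= t * x ^+ n.*2 + (1 - t) * y ^+ n.*2.
Proof.
move=> t01; have /andP[t0 t1] := t01.
rewrite -muln2 mulnC !exprM.
apply: le_trans (convex_expr n t01 (sqr_ge0 x) (sqr_ge0 y)).
have s0 : 0 <= 1 - t by rewrite subr_ge0.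
apply: lerXn2r; rewrite ?nnegrE ?sqr_ge0//.
  by rewrite addr_ge0// mulr_ge0// sqr_ge0.
rewrite -subr_ge0 [leRHS](_ : _ = t * (1 - t) * (x - y) ^+ 2); last by ring.
by rewrite mulr_ge0 ?sqr_ge0// mulr_ge0.
Qed.

(** * The inner product of l2 *)

Section ell2_inner_product.
Context (R : realType).
Implicit Types u v w : ell2 R.

Definition dot u v : R := limn [series u n * v n]_n.

Lemma dot_cvg u v : cvgn [series u n * v n]_n.
Proof.
have cg : cvgn [series 1 * (u n ^+ 2) + v n ^+ 2]_n.
  by apply: cvg_series_linear; exact: ell2_cvg.
apply: (series_dominated _ cg).1 => n /=.
rewrite normrM mul1r -(real_normK (num_real (u n))).
rewrite -(real_normK (num_real (v n))).
have := sqr_ge0 (`|u n| - `|v n|); have := normr_ge0 (u n).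
have := normr_ge0 (v n); nra.
Qed.

Lemma dotC u v : dot u v = dot v u.
Proof.
by congr (limn (series _)); apply/funext => n /=; rewrite mulrC.
Qed.

Lemma dot_scalar u : scalar (dot u).
Proof.
move=> c v w; rewrite /dot -(lim_series_linear _ (@dot_cvg _ _) (@dot_cvg _ _)).
congr (limn (series _)); apply/funext => n.
rewrite -[LHS]/(u n * (c * v n + w n)) -[RHS]/(c * (u n * v n) + u n * w n).
by ring.
Qed.

Lemma dotDr u v w : dot u (v + w) = dot u v + dot u w.
Proof. by have := dot_scalar u 1 v w; rewrite scale1r mul1r. Qed.

Lemma dot0r u : dot u 0 = 0.
Proof. by have := dotDr u 0 0; rewrite addr0; lra. Qed.

Lemma dotZr u v c : dot u (c *: v) = c * dot u v.
Proof. by have := dot_scalar u c v 0; rewrite addr0 dot0r addr0. Qed.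

Lemma dotDl u v w : dot (u + v) w = dot u w + dot v w.
Proof. by rewrite dotC dotDr dotC [dot w v]dotC. Qed.

Lemma dotZl u v c : dot (c *: u) v = c * dot u v.
Proof. by rewrite dotC dotZr dotC. Qed.

Lemma dot_norm u : dot u u = `|u| ^+ 2.
Proof.
rewrite -[`|u|]/(ell2_norm u) /ell2_norm sqr_sqrtr//.
by apply: series_ge0_lim => [n|]; [exact: sqr_ge0|exact: ell2_cvg].
Qed.

Lemma norm_sqrD u v : `|u + v| ^+ 2 = `|u| ^+ 2 + 2 * dot u v + `|v| ^+ 2.
Proof. by rewrite -!dot_norm dotDl !dotDr [dot v u]dotC; ring. Qed.

Lemma norm_sqr_comb (b c : R) u v : `|b *: u + c *: v| ^+ 2 =
  b ^+ 2 * `|u| ^+ 2 + 2 * (b * c) * dot u v + c ^+ 2 * `|v| ^+ 2.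
Proof.
rewrite norm_sqrD !normrZ dotZl dotZr !exprMn !real_normK ?num_real//.
by ring.
Qed.

(** Expansion of the squared norms of [|v| u + |u| v] and [|v| u - |u| v]. *)
Lemma dot_le u v : `|dot u v| <= `|u| * `|v|.
Proof.
have [->|u0] := eqVneq u 0; first by rewrite dotC dot0r !normr0 mul0r.
have [->|v0] := eqVneq v 0; first by rewrite dot0r !normr0 mulr0.
have nu : 0 < `|u| by rewrite normr_gt0.
have nv : 0 < `|v| by rewrite normr_gt0.
have key (c : R) : `|c| = `|u| -> 0 <= `|u| * (`|u| * `|v| ^+ 2) + c * `|v| * dot u v.
  move=> cu; have := sqr_ge0 (`| `|v| *: u + c *: v|).
  rewrite norm_sqrD !normrZ dotZl dotZr cu normr_id.
  by set a := dot u v; nra.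
have k1 := key `|u| (normr_id _).
have := key (- `|u|); rewrite normrN normr_id => /(_ erefl) k2.
have uv0 : 0 < `|u| * `|v| by rewrite mulr_gt0.
rewrite ler_norml; apply/andP; split.
  by rewrite -(ler_pM2l uv0); nra.
by rewrite -(ler_pM2l uv0); nra.
Qed.

(** Bessel's inequality for the coordinate vectors with indices in [s]. *)
Lemma ell2_bessel u (s : seq nat) : uniq s ->
  \sum_(i <- s) u i ^+ 2 <= `|u| ^+ 2.
Proof.
move=> us; rewrite -dot_norm.
pose N := (\max_(i <- s) i).+1.
have sN i : i \in s -> (i < N)%N.
  by move=> si; rewrite ltnS; exact: leq_bigmax_seq.
apply: le_trans (series_le_lim N _ (@dot_cvg u u)); last first.
  by move=> n; exact: sqr_ge0.
have ps : perm_eq s [seq i <- index_iota 0 N | i \in s].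
  apply: uniq_perm => //; first by rewrite filter_uniq// iota_uniq.
  move=> i; rewrite mem_filter mem_index_iota/=.
  by case: (boolP (i \in s)) => // /sN ->.
rewrite (perm_big _ ps) big_filter big_mkcond; apply: ler_sum => i _.
rewrite -[leRHS]/(u i ^+ 2).
by case: ifP => // _; exact: sqr_ge0.
Qed.

Lemma ell2_coord_cvg0 u : u n @[n --> \oo] --> (0 : R).
Proof.
have u20 := @cvg_series_cvg_0 R R^o _ (@ell2_cvg R u).
apply/cvgrPdist_le => e e0.
move/cvgrPdist_le : u20 => /(_ (e ^+ 2) (exprn_gt0 _ e0)).
apply: filterS => n; rewrite !sub0r !normrN normrX => h.
by rewrite -(@ler_pXn2r _ 2) ?nnegrE// ltW.
Qed.

Lemma ell2_unit_summable k :
  (fun n => (n == k)%:R : R) \in @sqr_summable R.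
Proof.
apply/sqr_summableP/cvg_ex.
exists (\sum_(0 <= n < k.+1) (n == k)%:R ^+ 2); apply: series_finite => n kn.
by rewrite /= gtn_eqF// expr0n.
Qed.

Definition ell2_unit k : ell2 R := Ell2 (ell2_unit_summable k).

Lemma dot_unit u k : dot u (ell2_unit k) = u k.
Proof.
have c : [series u n * ell2_unit k n]_n @ \oo -->
    \sum_(0 <= n < k.+1) u n * (ell2_unit k n : R).
  by apply: series_finite => n kn; rewrite /= gtn_eqF// mulr0.
rewrite /dot (cvg_lim _ c)// big_nat_recr//= eqxx mulr1.
rewrite big_nat big1 ?add0r// => i /andP[_ ik].
by rewrite ltn_eqF// mulr0.
Qed.

Lemma norm_sqr_units (b c : R) i j : i != j ->
  `|b *: ell2_unit i + c *: ell2_unit j| ^+ 2 = b ^+ 2 + c ^+ 2.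
Proof.
move=> ij; rewrite norm_sqr_comb -!dot_norm !dot_unit /= !eqxx.
by rewrite (eq_sym j) (negbTE ij) mulr1n mulr0n; ring.
Qed.

Lemma norm_sqr_convex (t : R) u v : 0 <= t <= 1 ->
  `|t *: u + (1 - t) *: v| ^+ 2 <= t * `|u| ^+ 2 + (1 - t) * `|v| ^+ 2.
Proof.
move=> /andP[t0 t1]; rewrite norm_sqr_comb.
have := sqr_ge0 (`|1 *: u + (-1) *: v|); rewrite norm_sqr_comb => uv0.
rewrite -subr_ge0 [leRHS](_ : _ = t * (1 - t) *
  (1 ^+ 2 * `|u| ^+ 2 + 2 * (1 * -1) * dot u v + (-1) ^+ 2 * `|v| ^+ 2)).
  by rewrite mulr_ge0// mulr_ge0// subr_ge0.
by ring.
Qed.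

(** The expansion around [a] stops at degree 2:
    [|a + h|^2 = |a|^2 + 2 <a, h> + <h, h>]. *)
Lemma norm_sqr_analytic a : analytic_at (fun u : ell2 R => `|u| ^+ 2) a.
Proof.
pose A k : ('I_k -> ell2 R) -> R :=
  match k return ('I_k -> ell2 R) -> R with
  | 0 => fun _ => `|a| ^+ 2
  | 1 => fun p => 2 * dot a (p ord0)
  | 2 => fun p => dot (p ord0) (p ord_max)
  | _ => fun _ => 0
  end.
pose M k : R := match k with 0 => `|a| ^+ 2 | 1 => 2 * `|a| | 2 => 1 | _ => 0 end.
exists A, M, 1; split => //.
- move=> [|[|[|k]]]; split.
  + by case.
  + by move=> v; rewrite big_ord0 mulr1 ger0_norm ?sqr_ge0.
  + by move=> i v c x y; rewrite /A !ord1 /= dot_scalar; ring.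
  + move=> v; rewrite big_ord1 normrM ger0_norm// -mulrA ler_wpM2l//.
    exact: dot_le.
  + move=> i v c x y; rewrite /A /=.
    case: (unliftP ord0 i) => [j|] ->.
      by rewrite ord1 /= dot_scalar.
    by rewrite /= dotDl dotZl.
  + move=> v; rewrite big_ord_recl big_ord1 mul1r.
    rewrite (_ : lift _ _ = ord_max); last exact: val_inj.
    exact: dot_le.
  + by move=> i v c x y; rewrite /A mulr0 addr0.
  + by move=> v; rewrite normr0 mul0r.
- split; first by move=> [|[|[|k]]] /=; rewrite ?sqr_ge0 ?mulr_ge0.
  apply/cvg_ex; exists (\sum_(0 <= k < 3) M k * 1 ^+ k).
  by apply: series_finite => -[|[|[|k]]] //= _; rewrite mul0r.
- move=> h _; have -> : `|a + h| ^+ 2 = \sum_(0 <= k < 3) A k (fun=> h).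
    by rewrite norm_sqrD -(dot_norm h) !big_nat_recr//= big_geq// add0r.
  by apply: series_finite => -[|[|[|k]]].
Qed.

End ell2_inner_product.

(** * The tilted_form sum *)

Section tilted_sum.
Context (R : realType).
Implicit Types (x y u v h : ell2 R) (n m : nat).

(** The pair 5, 12, 13 is Pythagorean, so these functionals have norm 1; the
    weight 5/13 of the first coordinate is below 1/2, which leaves room on the
    ball of radius 2. *)
Definition tilted_form n x : R := (5 * x 0%N + 12 * x n.+1) / 13.

Lemma tilted_form_scalar n : scalar (tilted_form n).
Proof.
move=> c x y; rewrite /tilted_form !ell2DE !ell2ZE.
by field.
Qed.

Lemma coord_le x n : `|x n| <= `|x|.
Proof.
rewrite -(@ler_pXn2r _ 2) ?nnegrE// real_normK ?num_real//.
by have := @ell2_bessel R x [:: n] isT; rewrite big_seq1.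
Qed.

Lemma tilted_form_le n x : `|tilted_form n x| <= `|x|.
Proof.
rewrite -(@ler_pXn2r _ 2) ?nnegrE// real_normK ?num_real//.
apply: le_trans (@ell2_bessel R x [:: 0%N; n.+1] isT).
rewrite big_cons big_seq1 /tilted_form.
have := sqr_ge0 (12 * x 0%N - 5 * x n.+1).
by nra.
Qed.

(** 194/169 = 1 + 25/169 is the largest eigenvalue of the Gram matrix of the two
    representing vectors, whose inner product is 25/169. *)
Lemma tilted_form_gram n m x : n != m ->
  tilted_form n x ^+ 2 + tilted_form m x ^+ 2 <= 194 / 169 * `|x| ^+ 2.
Proof.
move=> nm.
have := @ell2_bessel R x [:: 0%N; n.+1; m.+1].
rewrite /= !inE eqSS nm => /(_ isT).
rewrite !big_cons big_nil addr0 /tilted_form.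
have := sqr_ge0 (6 * x 0%N - 5 * x n.+1).
have := sqr_ge0 (6 * x 0%N - 5 * x m.+1).
by nra.
Qed.

(** On the ball of radius 2 the first coordinate contributes at most 10/13; the
    other one is eventually at most 1/12 and contributes 1/13.  The radius 1/13
    brings the total to 12/13. *)
Lemma tilted_form_majorant x : `|x| < 2 ->
  cvgn (series (ridge_majorant tilted_form (fun=> 1) double 13^-1 x)).
Proof.
move=> x2; pose q : R := (12 / 13) ^+ 2.
apply: (@cvg_series_near_geometric R _ q); first by apply/andP; split; rewrite /q; lra.
have /cvgrPdist_le/(_ 12^-1) := @ell2_coord_cvg0 R x.
rewrite invr_gt0 ltr0n => /(_ isT) [N _ xN].
exists N => // n /= Nn.
have := xN n.+1 (leqW Nn); rewrite /= sub0r normrN => xn.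
have x0 : `|x 0%N| < 2 by apply: le_lt_trans (coord_le x 0) x2.
have l0 : 0 <= `|tilted_form n x| + 13^-1 by rewrite addr_ge0.
rewrite /ridge_majorant mul1r ger0_norm ?exprn_ge0// /q -exprM mul2n.
apply: lerXn2r; rewrite ?nnegrE//.
have : `|tilted_form n x| <= (5 * `|x 0%N| + 12 * `|x n.+1|) / 13.
  rewrite /tilted_form normrM [`|13^-1|]ger0_norm// ler_wpM2r//.
  by apply: le_trans (ler_normD _ _) _; rewrite !normrM [`|5|]ger0_norm// [`|12|]ger0_norm.
lra.
Qed.

Definition tilted_sum : ell2 R -> R := ridge tilted_form (fun=> 1) double.

Lemma tilted_sum_cvg x : `|x| < 2 -> cvgn [series tilted_form n x ^+ n.*2]_n.
Proof.
move=> x2; have xc := tilted_form_majorant x2.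
apply: (series_dominated _ xc).1 => n.
rewrite /ridge_majorant mul1r normrX.
by apply: lerXn2r; rewrite ?nnegrE// lerDl.
Qed.

Lemma tilted_sumE x : tilted_sum x = limn [series tilted_form n x ^+ n.*2]_n.
Proof. by congr (limn (series _)); apply/funext => n /=; rewrite mul1r. Qed.

Lemma tilted_sum_ge0 x : `|x| < 2 -> 0 <= tilted_sum x.
Proof.
move=> x2; rewrite tilted_sumE; apply: series_ge0_lim; last exact: tilted_sum_cvg.
by move=> n; rewrite exprn_even_ge0// odd_double.
Qed.

Lemma tilted_sum_convex (t : R) x y : 0 <= t <= 1 -> `|x| < 2 -> `|y| < 2 ->
  tilted_sum (t *: x + (1 - t) *: y) <=
  t * tilted_sum x + (1 - t) * tilted_sum y.
Proof.
move=> t01 x2 y2; have /andP[t0 t1] := t01.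
have s0 : 0 <= 1 - t by rewrite subr_ge0.
have z2 : `|t *: x + (1 - t) *: y| < 2.
  apply: le_lt_trans (ler_normD _ _) _; rewrite !normrZ !ger0_norm//.
  have [tp|tn] := ltP 0 t; first by nra.
  have -> : t = 0 by lra.
  by rewrite mul0r add0r subr0 mul1r.
have cx := tilted_sum_cvg x2; have cy := tilted_sum_cvg y2.
rewrite !tilted_sumE -(lim_series_scale (1 - t) cy) -lim_series_linear//; last first.
  exact: cvg_series_scale.
apply: lim_series_le; first exact: tilted_sum_cvg.
  by apply: cvg_series_linear => //; exact: cvg_series_scale.
move=> n /=; rewrite tilted_form_scalar.
have -> : tilted_form n ((1 - t) *: y) = (1 - t) * tilted_form n y.
  by rewrite /tilted_form !ell2ZE; field.
exact: convex_even_expr.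
Qed.

(** Since 194/169 < 4/3, at most one index has a squared value above 2/3.
    That summand is at most 1, the others are below a geometric series. *)
Lemma tilted_sum_bounded : exists M : R, forall x, `|x| <= 1 -> tilted_sum x <= M.
Proof.
pose G := limn (series (geometric (1 : R) (2 / 3))).
exists (1 * G + 1) => x x1.
have Lx m : tilted_form m x ^+ 2 <= 1.
  rewrite -(real_normK (num_real _)) expr_le1//.
  exact: le_trans (tilted_form_le m x) x1.
have x12 : `|x| ^+ 2 <= 1 by rewrite expr_le1.
have [n0 small] : exists n0, forall n, n != n0 -> tilted_form n x ^+ 2 <= 2 / 3.
  have [[n0 big]|nobig] := pselect (exists n, 2 / 3 < tilted_form n x ^+ 2).
    exists n0 => n nn0; have := tilted_form_gram x nn0; lra.
  exists 0%N => n _; rewrite leNgt; apply/negP => big; apply: nobig.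
  by exists n.
have cG : cvgn (series (geometric (1 : R) (2 / 3))).
  by apply: is_cvg_geometric_series; rewrite ger0_norm; lra.
have sd := @series_finite R (fun n => (n == n0)%:R) n0.+1
  (fun n kn => congr1 (fun b : bool => b%:R) (gtn_eqF kn)).
have ld : limn [series (n == n0)%:R : R]_n = 1.
  rewrite (cvg_lim _ sd)// big_nat_recr//= eqxx big_nat big1 ?add0r//.
  by move=> i /andP[_ ik]; rewrite ltn_eqF.
have cd : cvgn [series (n == n0)%:R : R]_n by apply/cvg_ex; eexists; exact: sd.
have -> : 1 * G + 1 =
    limn [series 1 * geometric (1 : R) (2 / 3) n + (n == n0)%:R]_n.
  by rewrite lim_series_linear// ld.
rewrite tilted_sumE; apply: lim_series_le.
- by apply: tilted_sum_cvg; lra.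
- exact: cvg_series_linear.
move=> n /=; rewrite !mul1r -mul2n exprM.
have [->|/small nn0] := eqVneq n n0.
  apply: (@le_trans _ _ 1); first by rewrite exprn_ile1 ?sqr_ge0.
  by rewrite lerDr exprn_ge0//; lra.
by rewrite addr0; apply: lerXn2r; rewrite ?nnegrE ?sqr_ge0//; lra.
Qed.

(** The unit vector representing [tilted_form n] is [spike n (5 / 13) (12 / 13)];
    the other spikes in use are its perturbations in the plane of
    [e_0] and [e_(n+1)]. *)
Definition spike n (b c : R) : ell2 R :=
  b *: ell2_unit R 0 + c *: ell2_unit R n.+1.

Lemma tilted_form_spike n b c : tilted_form n (spike n b c) = (5 * b + 12 * c) / 13.
Proof.
by rewrite /tilted_form /spike !ell2DE !ell2ZE /= !eqxx; rewrite !mulr0n !mulr1n; field.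
Qed.

Lemma tilted_form_spike_neq n m b c : m != n -> tilted_form m (spike n b c) = 5 / 13 * b.
Proof.
move=> mn; rewrite /tilted_form /spike !ell2DE !ell2ZE /= eqSS (negbTE mn).
by rewrite mulr1n !mulr0n; field.
Qed.

(** A comparison of all the summands keeps the gap of a single one. *)
Lemma tilted_sum_termwise n x y : `|x| < 2 -> `|y| < 2 ->
  (forall m, tilted_form m x ^+ m.*2 <= tilted_form m y ^+ m.*2) ->
  tilted_sum x + (tilted_form n y ^+ n.*2 - tilted_form n x ^+ n.*2) <= tilted_sum y.
Proof.
move=> /tilted_sum_cvg cx /tilted_sum_cvg cy xy.
have ge0 m : 0 <= -1 * tilted_form m x ^+ m.*2 + tilted_form m y ^+ m.*2.
  by rewrite mulN1r addrC subr_ge0.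
rewrite addrC -lerBrDr.
have -> : tilted_sum y - tilted_sum x =
    limn [series -1 * tilted_form m x ^+ m.*2 + tilted_form m y ^+ m.*2]_m.
  by rewrite (lim_series_linear (-1) cx cy) mulN1r addrC !tilted_sumE.
have le_lim := series_le_lim n.+1 ge0 (@cvg_series_linear _ _ _ (-1) cx cy).
apply: le_trans le_lim.
rewrite big_nat_recr//= mulN1r [- _ + _]addrC lerDr.
by apply: sumr_ge0 => m _; exact: ge0.
Qed.

Lemma bernoulli_decay (s : R) n : 0 <= s <= 1 ->
  (1 - s) ^+ n * (1 + n%:R * s) <= 1.
Proof.
move=> /andP[s0 s1]; have t0 : 0 <= 1 - s by rewrite subr_ge0.
elim: n => [|n IH]; first by rewrite mul0r addr0 mulr1.
apply: le_trans IH; rewrite exprSr -mulrA ler_wpM2l ?exprn_ge0//.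
have n0 : 0 <= n%:R :> R by [].
by rewrite -natr1; nra.
Qed.

(** With [u] the unit vector representing [tilted_form n] and
    [y = (26 / 5) e_0], the spike here is [z = u - s (y - u)].  The three claims
    are [|z|^2 <= 1], the value of [tilted_form n] at [z], and that no other
    [tilted_form m] grows in absolute value from [u] to [z]. *)
Lemma spike_estimates (s : R) : 0 < s -> s <= 13^-1 ->
  [/\ (5 / 13 * (1 + s) - 26 / 5 * s) ^+ 2 + (12 / 13 * (1 + s)) ^+ 2 <= 1,
      (5 * (5 / 13 * (1 + s) - 26 / 5 * s) + 12 * (12 / 13 * (1 + s))) / 13
        = 1 - s
    & (5 / 13 * (5 / 13 * (1 + s) - 26 / 5 * s)) ^+ 2
        <= (5 / 13 * (5 / 13)) ^+ 2].
Proof. by move=> s0 s13; split; [nra|lra|nra]. Qed.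

Lemma spike_conv n (s : R) : 0 < s ->
  spike n (5 / 13) (12 / 13) =
  (1 + s)^-1 *: spike n (5 / 13 * (1 + s) - 26 / 5 * s) (12 / 13 * (1 + s))
  + (1 - (1 + s)^-1) *: ((26 / 5) *: ell2_unit R 0).
Proof.
move=> s0; have s10 : 1 + s != 0 by rewrite gt_eqF// addr_gt0.
apply/val_inj/funext => k; set t := (1 + s)^-1; set b := _ - _.
rewrite -[LHS]/(5 / 13 * (k == 0%N)%:R + 12 / 13 * (k == n.+1)%:R).
rewrite -[RHS]/(t * (b * (k == 0%N)%:R + 12 / 13 * (1 + s) * (k == n.+1)%:R)
  + (1 - t) * (26 / 5 * (k == 0%N)%:R)).
by rewrite /t /b; field.
Qed.

(** With [s = 1 / n], moving from [u] by [- s (y - u)] stays in the unit ball and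
    lowers the summand of index [n] from 1 to [(1 - s) ^ (2 n)], which is at
    most 1/2 by Bernoulli's inequality, while no other summand increases.  The
    bound 13 on [n] makes [s] small enough for [spike_estimates]. *)
Lemma tilted_sum_steep n (s : R) : (13 <= n)%N -> n%:R * s = 1 ->
  exists u z : ell2 R,
  [/\ `|u| = 1, `|z| <= 1,
      u = (1 + s)^-1 *: z + (1 - (1 + s)^-1) *: ((26 / 5) *: ell2_unit R 0)
    & tilted_sum z + 2^-1 <= tilted_sum u].
Proof.
move=> n13 ns; have n0 : 13 <= n%:R :> R by rewrite ler_nat.
have s0 : 0 < s by nra.
have s13 : s <= 13^-1 by nra.
have [z1 zn zm] := spike_estimates s0 s13.
have conv := spike_conv n s0.
have decay : (1 - s) ^+ n.*2 <= 2^-1.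
  have s01 : 0 <= s <= 1 by apply/andP; split; lra.
  have := bernoulli_decay n s01; rewrite ns => half.
  rewrite -muln2 exprM expr2.
  have d0 : 0 <= (1 - s) ^+ n by rewrite exprn_ge0//; lra.
  by nra.
(* Only the facts just collected about the coordinates of [z] matter below. *)
move: (5 / 13 * (1 + s) - 26 / 5 * s) (12 / 13 * (1 + s)) z1 zn zm conv.
move=> b c z1 zn zm conv.
have u1 : (5 / 13) ^+ 2 + (12 / 13) ^+ 2 = 1 :> R by field.
have un : (5 * (5 / 13) + 12 * (12 / 13)) / 13 = 1 :> R by lra.
have decay1 : (1 - s) ^+ n.*2 <= 1 by apply: le_trans decay _; lra.
have drop : 2^-1 <= 1 - (1 - s) ^+ n.*2 by lra.
have mono m : tilted_form m (spike n b c) ^+ m.*2 <=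
    tilted_form m (spike n (5 / 13) (12 / 13)) ^+ m.*2.
  have [->|mn] := eqVneq m n; first by rewrite !tilted_form_spike zn un expr1n.
  rewrite !tilted_form_spike_neq// -mul2n !exprM.
  by apply: lerXn2r; rewrite ?nnegrE ?sqr_ge0.
have zle : `|spike n b c| <= 1 by rewrite -(@expr_le1 _ 2)// norm_sqr_units.
have ue : `|spike n (5 / 13) (12 / 13)| = 1.
  by apply/eqP; rewrite -(@eqrXn2 _ 2)// expr1n norm_sqr_units// u1.
have z2 := le_lt_trans zle (ltr1n _ 2).
have u2 : `|spike n (5 / 13) (12 / 13)| < 2 by rewrite ue ltr1n.
exists (spike n (5 / 13) (12 / 13)), (spike n b c); split; [exact: ue|exact: zle| |].
  exact: conv.
have := tilted_sum_termwise n z2 u2 mono.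
rewrite !tilted_form_spike zn un expr1n; apply: le_trans.
by rewrite lerD2l.
Qed.

(** As [u] lies between [z] and [y], with [u - z = s (y - u)], convexity gives
    [s * H y >= (F u - F z) + s * F u], where the gap is at least 1/2 and
    [s = 1 / n].  The point [y] does not depend on [n]. *)
Lemma no_convex_extension (H : ell2 R -> R) :
  (forall (t : R) x y, 0 <= t <= 1 ->
    H (t *: x + (1 - t) *: y) <= t * H x + (1 - t) * H y) ->
  ~ (forall x, `|x| <= 1 -> H x = `|x| ^+ 2 + tilted_sum x).
Proof.
move=> Hc HF.
set y : ell2 R := (26 / 5) *: ell2_unit R 0.
have key n : (13 <= n)%N -> n%:R / 2 <= H y.
  move=> n13; have n0 : 0 < n%:R :> R by rewrite ltr0n (leq_trans _ n13).
  have [s ns] : exists s : R, n%:R * s = 1.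
    by exists n%:R^-1; rewrite divff// gt_eqF.
  have s0 : 0 < s by rewrite -(pmulr_rgt0 _ n0) ns.
  have [u [z [u1 z1 mid steep]]] := tilted_sum_steep n13 ns.
  have t01 : 0 <= (1 + s)^-1 <= 1.
    by rewrite invr_ge0 ltW ?addr_gt0//= invf_le1 ?addr_gt0// lerDl ltW.
  have u2 : `|u| < 2 by rewrite u1 ltr1n.
  have Tu := tilted_sum_ge0 u2.
  have zz : `|z| ^+ 2 <= 1 by rewrite expr_le1.
  have conv := Hc _ z y t01; rewrite -mid in conv.
  rewrite (HF z z1) (HF u) ?u1// expr1n in conv.
  move: n0 s0 ns zz steep Tu conv.
  move: n%:R (`|z| ^+ 2) (tilted_sum z) (tilted_sum u) (H y).
  move=> {t01} N z2 Tz Tu Hy N0 s0 Ns zz steep Tu0 conv.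
  have : (1 + s) * (1 + Tu) <= z2 + Tz + s * Hy.
    have s1 : 0 < 1 + s by rewrite addr_gt0.
    rewrite -ler_pdivlMl//; apply: le_trans conv _.
    by rewrite le_eqVlt; apply/orP; left; apply/eqP; field; rewrite gt_eqF.
  by nra.
(* An [n] with [n / 2 > |H y|]. *)
pose n := maxn 13 (Num.bound (2 * `|H y|)).+1.
have : n%:R / 2 <= H y by apply: key; rewrite leq_maxl.
apply/negP; rewrite -ltNge.
have /archi_boundP h : 0 <= 2 * `|H y| by [].
have : (Num.bound (2 * `|H y|))%:R <= n%:R :> R.
  by rewrite ler_nat /n leq_max leqnSn orbT.
by have := ler_norm (H y); lra.
Qed.

End tilted_sum.

(** * The function and its derivatives *)

Section example.
Context (R : realType).
Implicit Types (x a h v : ell2 R).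

Definition example_fun x : R := `|x| ^+ 2 + tilted_sum x.

Let example_fun_grad x v := 2 * dot x v + ridge_grad (@tilted_form R) (fun=> 1) double x v.

Let example_fun_hess x h v :=
  2 * dot h v + ridge_hess (@tilted_form R) (fun=> 1) double x h v.

Let tscal := @tilted_form_scalar R.
Let tle := @tilted_form_le R.
Let r0 : 0 < 13^-1 :> R. Proof. by rewrite invr_gt0. Qed.
Let w1 (n : nat) : `|1 : R| <= 1. Proof. by rewrite normr1. Qed.

Lemma example_fun_analytic a : `|a| < 2 -> analytic_at example_fun a.
Proof.
move=> /tilted_form_majorant ca; apply: analytic_atD; first exact: norm_sqr_analytic.
exact: (ridge_analytic tscal tle r0 w1 ca).
Qed.

Lemma example_fun_differentiable a : `|a| < 2 ->
  differentiable example_fun a /\ forall v, 'd example_fun a v = example_fun_grad a v.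
Proof.
move=> /tilted_form_majorant ca.
set B := limn (series (ridge_majorant (@tilted_form R) (fun=> 1) double 13^-1 a)).
apply: (@differentiable_of_taylor _ _ _ _ _ (2 * `|a| + `|B / 13^-1|)
  (1 + B / 13^-1 ^+ 2) 13^-1).
- by [].
- by rewrite addr_ge0// mulr_ge0.
- move=> c x y; rewrite /example_fun_grad dot_scalar.
  by rewrite (ridge_grad_scalar tscal tle r0 w1 ca); ring.
- move=> v; apply: le_trans (ler_normD _ _) _; rewrite [leRHS]mulrDl lerD//.
    by rewrite normrM ger0_norm// -mulrA ler_wpM2l// dot_le.
  apply: le_trans (ridge_grad_le tle r0 w1 ca v) _.
  by rewrite ler_wpM2r// ler_norm.
- move=> h hr; have := ridge_taylor1 tscal tle r0 w1 ca hr.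
  rewrite -/B -/(tilted_sum _) -/(tilted_sum _) => Th.
  rewrite /example_fun /example_fun_grad norm_sqrD.
  move: Th; move: (tilted_sum (a + h)) (tilted_sum a) => s1 s2.
  move: (ridge_grad _ _ _ _ _) (dot a h) => g p Th.
  rewrite [leRHS]mulrDl mul1r.
  apply: le_trans (lerD (lexx (`|h| ^+ 2)) Th).
  rewrite [X in `|X|](_ : _ = `|h| ^+ 2 + (s1 - s2 - g)); last by ring.
  by apply: le_trans (ler_normD _ _) _; rewrite ger0_norm ?sqr_ge0.
Qed.

Lemma near_lt2 a : `|a| < 2 -> \forall x \near a, `|x| < 2.
Proof.
move=> a2; have e0 : 0 < (2 - `|a|) / 2 by rewrite divr_gt0// subr_gt0.
apply: filterS (near_dist_le a e0) => x xa.
rewrite -(subrK a x); apply: le_lt_trans (ler_normD _ _) _.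
move: xa a2; move: (`|x - a|) (`|a|) => p q; lra.
Qed.

Lemma example_fun_diff2 a : `|a| < 2 -> exists2 B : {biscalar (ell2 R)},
  is_diff2 example_fun a B & forall v, `|v| = 1 -> 1 <= B v v.
Proof.
move=> a2; have ca := tilted_form_majorant a2.
have [B BE] : exists B : {biscalar (ell2 R)}, forall h v, B h v = example_fun_hess a h v.
  apply: biscalar_of_linear.
    move=> h c x y; rewrite /example_fun_hess dot_scalar.
    by rewrite (ridge_hess_scalarr tscal tle r0 w1 ca); ring.
  move=> v c x y; rewrite /example_fun_hess dotDl dotZl.
  by rewrite (ridge_hess_scalarl tscal tle r0 w1 ca); ring.
set B' := limn (series (ridge_majorant (@tilted_form R) (fun n => 1 * (n.*2)%:R)
  (fun n => (n.*2).-1) (13^-1 / 2) a)).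
exists B; last first.
  move=> v v1; rewrite BE /example_fun_hess dot_norm v1.
  have := ridge_hess_ge0 tle r0 w1 ca v (fun=> ler01) (fun n => negbT (odd_double n)).
  move: (ridge_hess _ _ _ _ _ _) => g; lra.
apply: (@is_diff2_of_taylor _ _ example_fun a example_fun_grad B (2 + B' / (13^-1 / 2))
  `|B' / (13^-1 / 2) ^+ 2| (13^-1 / 2)).
- by rewrite divr_gt0.
- by [].
- by apply: filterS (near_lt2 a2) => x; exact: example_fun_differentiable.
- move=> h v; rewrite BE; apply: le_trans (ler_normD _ _) _.
  rewrite -[leRHS]mulrA [leRHS]mulrDl lerD//.
    by rewrite normrM ger0_norm// ler_wpM2l// dot_le.
  by rewrite mulrA; exact: (ridge_hess_le tle r0 w1 ca h v).
- move=> h v hr; have := ridge_grad_taylor tscal tle r0 w1 ca v hr.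
  rewrite -/B' BE /example_fun_grad /example_fun_hess dotDl => Th.
  rewrite [X in `|X|](_ : _ = ridge_grad (@tilted_form R) (fun=> 1) double (a + h) v
    - ridge_grad (@tilted_form R) (fun=> 1) double a v
    - ridge_hess (@tilted_form R) (fun=> 1) double a h v); last by ring.
  apply: le_trans Th _; rewrite ler_wpM2r// ler_wpM2r ?sqr_ge0//.
  exact: ler_norm.
Qed.

End example.

Theorem mainTheorem3 (R : realType) :
  let C := [set x : ell2 R | `|x| <= 1] in
  let U := [set x : ell2 R | `|x| < 2] in
  let S := [set x : ell2 R | `|x| = 1] in
  exists F : ell2 R -> R,
  [/\ forall x, U x -> analytic_at F x,
      convex_function U F /\
      (forall x, U x -> exists2 B : {biscalar (ell2 R)},
        is_diff2 F x B & forall v, S v -> 1 <= B v v),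
      [bounded F x | x in C]
    & ~ exists H : ell2 R -> R,
        [/\ continuous H, convex_function [set: ell2 R] H
          & forall x, C x -> H x = F x]].
Proof.
move=> C U S; exists (@example_fun R); split.
- exact: example_fun_analytic.
- split; last exact: example_fun_diff2.
  apply/convex_functionP => t x y t01 Ux Uy.
  rewrite /example_fun; apply: le_trans (lerD (norm_sqr_convex x y t01)
    (tilted_sum_convex t01 Ux Uy)) _.
  by rewrite le_eqVlt; apply/orP; left; apply/eqP; ring.
- have [M TM] := @tilted_sum_bounded R.
  rewrite /bounded_near; near=> N => x x1.
  have x2 : `|x| < 2 by exact: le_lt_trans x1 (ltr1n _ 2).
  rewrite /= ger0_norm; last by rewrite addr_ge0 ?sqr_ge0 ?tilted_sum_ge0.
  apply: (@le_trans _ _ (1 + M)); first by rewrite lerD ?TM// expr_le1.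
  by near: N; apply: nbhs_pinfty_ge; exact: num_real.
- move=> [H [_ /convex_functionP Hc HF]].
  by apply: (@no_convex_extension R H) => // t x y t01; exact: Hc.
Unshelve. all: by end_near. Qed.
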